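(* Let $\widetilde{\mathcal M}$ be the noisy fermionic shadow channel on $n$ qubits, $$\widetilde{\mathcal M}(A)=\int_{\mathrm{Orth}(2n)}d\mu(Q)\sum_{x\in\{0,1\}^n}\langle x|\Lambda(U_QAU_Q^\dagger)|x\rangle\;U_Q^\dagger|x\rangle\langle x|U_Q .$$ Then $\widetilde{\mathcal M}=\sum_{k=0}^nf_{2k}\mathcal P_{2k}$ for some coefficients $f_{2k}\in\mathbb R$. Moreover, if $Q$ is sampled uniformly (the matchgate $U_Q$ is uniformly random in the matchgate group), the noisy circuit $A\mapsto\Lambda(U_QAU_Q^\dagger)$ is applied to the input state $|0^n\rangle\langle0^n|$, and a computational-basis measurement gives outcome $x$, then for every $k\in\{0,\dots,n\}$ $$\hat f_{2k}=\frac{2^n}{\binom nk}\,\mathrm{Tr}\Big(|0^n\rangle\langle0^n|\;\mathcal P_{2k}\big(U_Q^\dagger|x\rangle\langle x|U_Q\big)\Big)$$ is an unbiased estimator of $f_{2k}$, i.e. $\mathbb E[\hat f_{2k}]=f_{2k}$, the expectation being over $Q$ and $x$.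
   Context: Majorana operators: on $n$ qubits (identified with $n$ fermionic modes by Jordan–Wigner), $\gamma_1,\dots,\gamma_{2n}$ are Hermitian with $\gamma_i\gamma_j+\gamma_j\gamma_i=2\delta_{ij}\mathbb I$, normalized so that $|x\rangle\langle x|=\prod_{j=1}^n\frac12(\mathbb I-i(-1)^{x_j}\gamma_{2j-1}\gamma_{2j})$ for $x\in\{0,1\}^n$. For $S=\{l_1<\dots<l_{|S|}\}\subseteq\{1,\dots,2n\}$, $\gamma_S=\gamma_{l_1}\cdots\gamma_{l_{|S|}}$, $\gamma_\emptyset=\mathbb I$. $\mathcal P_k(A)=2^{-n}\sum_{|S|=k}\mathrm{Tr}(\gamma_S^\dagger A)\gamma_S$ is the projector onto $\Gamma_k=\mathrm{span}\{\gamma_S:|S|=k\}$. For $Q\in\mathrm{Orth}(2n)$ (real orthogonal group, normalized Haar measure $\mu$), $U_Q$ is the unitary (unique up to phase) with $U_Q^\dagger\gamma_jU_Q=\sum_kQ_{jk}\gamma_k$; the matchgate group is $\{U_Q:Q\in\mathrm{Orth}(2n)\}$. Noise is gate-independent, time-stationary and Markovian: $\Lambda$ is a fixed completely positive trace-preserving map applied after the ideal gate; the preparation of $|0^n\rangle\langle 0^n|$ is noiseless. *)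

(* Defs.v *)
(* MathComp-Analysis; R[i] is the field of complex numbers over R. *)
From HB Require Import structures.
From mathcomp Require Export all_boot all_order all_algebra.
From mathcomp Require Export complex.
From mathcomp Require Export all_classical all_reals all_analysis.

Set Implicit Arguments.
Unset Strict Implicit.
Unset Printing Implicit Defensive.

Import Order.TTheory GRing.Theory Num.Theory.
Import numFieldNormedType.Exports.

Local Open Scope classical_set_scope.
Local Open Scope ring_scope.
Local Open Scope complex_scope.
Local Open Scope sesquilinear_scope.

Definition bits (n : nat) := {ffun 'I_n -> bool}.

Definition zeros (n : nat) : bits n := [ffun=> false].

(* Operators on n qubits: the computational basis is indexed by bit strings, of
   which there are #|bits n| = 2 ^ n. *)
Notation qop R n := 'M[R[i]]_#|bits n|.

Definition expval (R : realType) (n : nat) (x : bits n) (A : qop R n) : R[i] :=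
  A (enum_rank x) (enum_rank x).

Definition ketbra (R : realType) (n : nat) (x : bits n) : qop R n :=
  delta_mx (enum_rank x) (enum_rank x).

Section Majorana.
Variables (R : realType) (n : nat).

(* With indices starting at 0, the modes 2j-1 and 2j become 2j and 2j+1. *)
Lemma mode_odd_subproof (j : 'I_n) : (j.*2 < n.*2)%N.
Proof. by rewrite ltn_double. Qed.

Lemma mode_even_subproof (j : 'I_n) : (j.*2.+1 < n.*2)%N.
Proof. by rewrite ltn_Sdouble. Qed.

Definition mode_odd (j : 'I_n) : 'I_n.*2 := Ordinal (mode_odd_subproof j).
Definition mode_even (j : 'I_n) : 'I_n.*2 := Ordinal (mode_even_subproof j).

(* The last field fixes the representation: it expresses the computational basis
   projectors through the gamma's.  The factors of the product commute. *)
Record majorana (gamma : 'I_n.*2 -> qop R n) : Prop := Majorana {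
  majorana_herm : forall i, (gamma i) ^t* = gamma i;
  majorana_anticomm : forall i j,
    gamma i *m gamma j + gamma j *m gamma i = (2 *+ (i == j))%:M;
  majorana_ketbra : forall x : bits n,
    ketbra R x = \prod_(j < n)
      (2^-1 *: (1%:M - ('i * (-1) ^+ x j)
                         *: (gamma (mode_odd j) *m gamma (mode_even j)))) }.

Variable gamma : 'I_n.*2 -> qop R n.

(* Ordinals are enumerated in increasing order, hence so are the factors. *)
Definition majorana_prod (S : {set 'I_n.*2}) : qop R n :=
  \prod_(l in S) gamma l.

Definition proj_degree (k : nat) (A : qop R n) : qop R n :=
  2 ^- n *: \sum_(S : {set 'I_n.*2} | #|S| == k)
    \tr ((majorana_prod S) ^t* *m A) *: majorana_prod S.

Definition implements (Q : 'M[R]_n.*2) (U : qop R n) : Prop :=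
  U \is unitarymx /\
  forall j, U ^t* *m gamma j *m U = \sum_k (Q j k)%:C *: gamma k.

End Majorana.

Section Channel.
Variable R : realType.

Definition psdmx (m : nat) (A : 'M[R[i]]_m) : Prop :=
  forall v : 'rV[R[i]]_m, 0 <= (v *m A *m v ^t*) 0 0.

(* id_m (x) L, acting blockwise on M_m(M_N). *)
Definition ampliation (N m : nat) (L : 'M[R[i]]_N -> 'M[R[i]]_N)
    (X : 'M[R[i]]_(\sum_(i < m) N)) : 'M[R[i]]_(\sum_(i < m) N) :=
  \mxblock_(i < m, j < m) L (submxblock X i j).

Definition completely_positive (N : nat) (L : 'M[R[i]]_N -> 'M[R[i]]_N) : Prop :=
  forall m (X : 'M[R[i]]_(\sum_(i < m) N)), psdmx X -> psdmx (ampliation L X).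

Definition trace_preserving (N : nat) (L : 'M[R[i]]_N -> 'M[R[i]]_N) : Prop :=
  forall A, \tr (L A) = \tr A.

End Channel.

Section Haar.
Variables (R : realType) (m : nat).

Definition borel_mx := g_sigma_algebraType (@open 'M[R]_m).
HB.instance Definition _ := Measurable.on borel_mx.

Definition Orth : set borel_mx := [set Q : 'M[R]_m | Q *m Q^T = 1%:M].

(* A Borel probability on Orth(m) is represented as one on m x m matrices that
   is concentrated on the closed set Orth(m).  Compact groups being unimodular,
   the normalized Haar measure is invariant on both sides. *)
Definition is_haar (mu : probability borel_mx R) : Prop :=
  mu Orth = 1%E /\
  forall P : 'M[R]_m, Orth P -> forall B : set borel_mx, measurable B ->
    mu [set Q : 'M[R]_m | B (P *m Q)] = mu B /\
    mu [set Q : 'M[R]_m | B (Q *m P)] = mu B.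

Variable mu : probability borel_mx R.

Definition orth_integral (f : 'M[R]_m -> R[i]) : R[i] :=
  (\int[mu]_(Q in Orth) complex.Re (f Q))
  +i* (\int[mu]_(Q in Orth) complex.Im (f Q)).

Definition orth_integral_mx (N : nat) (F : 'M[R]_m -> 'M[R[i]]_N) : 'M[R[i]]_N :=
  \matrix_(i, j) orth_integral (fun Q => F Q i j).

End Haar.

Section Shadow.
Variables (R : realType) (n : nat).
Variable gamma : 'I_n.*2 -> qop R n.
Variable mu : probability (borel_mx R n.*2) R.
Variable L : qop R n -> qop R n.
Variable U : 'M[R]_n.*2 -> qop R n.

Definition noisy_circuit (Q : 'M[R]_n.*2) (A : qop R n) : qop R n :=
  L (U Q *m A *m (U Q) ^t*).

Definition rotated_ketbra (Q : 'M[R]_n.*2) (x : bits n) : qop R n :=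
  (U Q) ^t* *m ketbra R x *m U Q.

Definition shadow_channel (A : qop R n) : qop R n :=
  orth_integral_mx mu (fun Q =>
    \sum_(x : bits n) expval x (noisy_circuit Q A) *: rotated_ketbra Q x).

Definition outcome_prob (Q : 'M[R]_n.*2) (x : bits n) : R[i] :=
  expval x (noisy_circuit Q (ketbra R (zeros n))).

(* Q is drawn from mu and then, given Q, x is drawn with the Born probability
   outcome_prob Q x. *)
Definition shadow_expectation (g : 'M[R]_n.*2 -> bits n -> R[i]) : R[i] :=
  orth_integral mu (fun Q => \sum_(x : bits n) outcome_prob Q x * g Q x).

Definition fhat (k : nat) (Q : 'M[R]_n.*2) (x : bits n) : R[i] :=
  2 ^+ n / 'C(n, k)%:R *
  \tr (ketbra R (zeros n) *m proj_degree gamma k.*2 (rotated_ketbra Q x)).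

End Shadow.

(* Main.v *)
Require Import Defs.
From mathcomp Require Import fingroup perm ring lra measurable_realfun.

(* Write m_AB(Q) for the coefficient of gamma_B in U_Q^dagger gamma_A U_Q.  Both
   U_Q A U_Q^dagger and U_Q^dagger |x><x| U_Q are linear in the m_AB(Q) and
   their conjugates, so everything reduces to the orthogonality relations
     int conj(m_AB) m_CD = [A = C] [B = D] [|A| = |B|] / binom(2n, |A|).
   The indices are separated by invariance under 2 e_i e_i^T - 1, which
   multiplies m_AB by a sign; over all i these signs determine A (acting from
   the left) or B (from the right).  Conjugation by U_Q commutes with
   X |-> sum_j gamma_j X gamma_j, whose eigenvalue on gamma_A determines |A|;
   hence m_AB = 0 unless |A| = |B|.  Permutation matrices act transitively on
   the sets B of a given size and sum_B |m_AB|^2 = 1, which gives the constant.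

   Up to a positive factor, f_2k is a sum of entries Lambda(H)_xx with H
   Hermitian, which complete positivity makes real.  The estimator is a linear
   functional of the channel output, so its expectation is that functional
   applied to the channel at |0><0|. *)

Set Implicit Arguments.
Unset Strict Implicit.
Unset Printing Implicit Defensive.

Import Order.TTheory GRing.Theory Num.Theory.
Import numFieldNormedType.Exports.
Local Open Scope ring_scope.
Local Open Scope complex_scope.
Local Open Scope sesquilinear_scope.

(** * Integration over the orthogonal group *)

Section OrthIntegral.
Local Open Scope classical_set_scope.
Variables (R : realType) (m : nat).
Notation T := (borel_mx R m).

Lemma mx_continuous (X : topologicalType) (f : X -> 'M[R]_m) :
  (forall i j, continuous (fun x => f x i j)) -> continuous f.
Proof.
move=> fc x A [P Pf PA].
have : \forall y \near x, forall i, forall j, P i j (f y i j).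
  apply: filter_forall => i; apply: filter_forall => j.
  exact: fc (Pf i j).
by apply: filterS => y Py; apply: PA.
Qed.

Lemma continuous_measurable_mx (f : 'M[R]_m -> 'M[R]_m) :
  continuous f -> measurable_fun [set: T] (f : T -> T).
Proof.
move=> fc; apply: (@measurability _ _ T T setT f (@open 'M[R]_m)) => //.
move=> _ [B oB <-]; rewrite setTI; apply: sub_sigma_algebra.
by apply: open_comp => // x _; exact: fc.
Qed.

Lemma continuous_measurable_real (f : 'M[R]_m -> R) :
  continuous f -> measurable_fun [set: T] (f : T -> R).
Proof.
move=> fc; apply: (measurability _ (RGenOInfty.measurableE R)) => //.
move=> _ [_ [a ->] <-]; rewrite setTI; apply: sub_sigma_algebra.
apply: open_comp => [x _|]; [exact: fc|exact: interval_open].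
Qed.

Lemma measurable_coord i j :
  measurable_fun [set: T] (fun Q : T => (Q : 'M[R]_m) i j).
Proof. by apply: continuous_measurable_real; exact: coord_continuous. Qed.

Lemma sum_continuous (X : topologicalType) (F : 'I_m -> X -> R) :
  (forall k, continuous (F k)) -> continuous (fun x => \sum_k F k x).
Proof.
move=> Fc.
exact: (@continuous_big R 'I_m +%R 0 xpredT (@add_continuous R)).
Qed.

Lemma measurable_mulmxl (P : 'M[R]_m) :
  measurable_fun [set: T] (mulmx P : T -> T).
Proof.
apply: continuous_measurable_mx; apply: mx_continuous => i j.
under [X in continuous X]funext do rewrite mxE.
apply: sum_continuous => k Q.
apply: (@cvgM _ _ (nbhs Q) _ (fun=> P i k)); first exact: cvg_cst.
exact: coord_continuous.
Qed.

Lemma measurable_mulmxr (P : 'M[R]_m) :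
  measurable_fun [set: T] (mulmxr P : T -> T).
Proof.
apply: continuous_measurable_mx; apply: mx_continuous => i j.
under [X in continuous X]funext do rewrite mxE.
apply: sum_continuous => k Q.
apply: (@cvgM _ _ (nbhs Q) _ _ (fun=> P k j)); last exact: cvg_cst.
exact: coord_continuous.
Qed.

Lemma measurable_Orth : measurable (@Orth R m).
Proof.
have -> : @Orth R m = \bigcap_(ij in [set: 'I_m * 'I_m])
    ((fun Q : T => \sum_k (Q : 'M[R]_m) ij.1 k * (Q : 'M[R]_m) ij.2 k) @^-1`
      [set (ij.1 == ij.2)%:R]).
  apply/seteqP; split=> [Q QQ [i j] _ /=|Q h].
    have := congr1 (fun M : 'M[R]_m => M i j) QQ; rewrite !mxE => <-.
    by apply: eq_bigr => k _; rewrite mxE.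
  apply/matrixP => i j; rewrite !mxE -(h (i, j) I).
  by apply: eq_bigr => k _; rewrite mxE.
apply: fin_bigcap_measurable => [|[i j] _]; first exact: finite_finset.
rewrite -[X in measurable X]setTI.
apply: (_ : measurable_fun setT _) => //.
by apply: measurable_sum => k; apply: measurable_funM; exact: measurable_coord.
Qed.

Lemma Orth_entry_le1 (Q : 'M[R]_m) i j : Orth Q -> `|Q i j| <= 1.
Proof.
move=> QQ; have := congr1 (fun M : 'M[R]_m => M i i) QQ.
rewrite !mxE eqxx mulr1n (bigD1 j) //= mxE => h.
have le1 : Q i j * Q i j <= 1.
  by rewrite -h lerDl; apply: sumr_ge0 => k _; rewrite mxE -expr2 sqr_ge0.
by rewrite -(@expr_le1 _ 2) // -normrX ger0_norm ?sqr_ge0 // expr2.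
Qed.

Lemma Orth_mul (P Q : 'M[R]_m) : Orth P -> Orth (P *m Q) <-> Orth Q.
Proof.
move=> PP; rewrite /Orth /= trmx_mul !mulmxA -(mulmxA P); split=> [h|->].
  have := congr1 (fun M => P^T *m M *m P) h.
  by rewrite mulmx1 !mulmxA (mulmx1C PP) mul1mx -mulmxA (mulmx1C PP) mulmx1.
by rewrite mulmx1.
Qed.

Lemma Orth_mulr (P Q : 'M[R]_m) : Orth P -> Orth (Q *m P) <-> Orth Q.
Proof.
move=> PP; rewrite /Orth /= trmx_mul !mulmxA -(mulmxA Q).
by rewrite PP mulmx1.
Qed.

(* The map Q |-> U Q is not assumed measurable: before integrating, an integrand
   is replaced by a tame function that agrees with it on Orth. *)
Record tame (f : 'M[R]_m -> R[i]) : Prop := Tame {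
  tame_Re : measurable_fun [set: T] (fun Q : T => complex.Re (f Q));
  tame_Im : measurable_fun [set: T] (fun Q : T => complex.Im (f Q));
  tame_bound : exists M : R, forall Q : 'M[R]_m, Orth Q -> `|f Q| <= M%:C }.

Lemma tame_cst c : tame (fun=> c).
Proof.
split; [exact: measurable_cst|exact: measurable_cst|].
by exists (complex.Re `|c|) => Q _; rewrite RRe_real ?normr_real.
Qed.

Lemma tameD f g : tame f -> tame g -> tame (fun Q => f Q + g Q).
Proof.
move=> [f1 f2 [M fM]] [g1 g2 [N gN]]; split.
- under [X in measurable_fun _ X]funext do rewrite raddfD.
  exact: measurable_funD.
- under [X in measurable_fun _ X]funext do rewrite raddfD.
  exact: measurable_funD.
- exists (M + N) => Q QQ; rewrite (le_trans (ler_normD _ _)) // rmorphD /=.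
  by rewrite lerD ?fM ?gN.
Qed.

Lemma tameM f g : tame f -> tame g -> tame (fun Q => f Q * g Q).
Proof.
move=> [f1 f2 [M fM]] [g1 g2 [N gN]]; split.
- have -> : (fun Q : T => complex.Re (f Q * g Q)) = (fun Q =>
      complex.Re (f Q) * complex.Re (g Q) - complex.Im (f Q) * complex.Im (g Q)).
    by apply/funext => Q; case: (f Q) (g Q) => [a b] [c d].
  by apply: measurable_funB; apply: measurable_funM.
- have -> : (fun Q : T => complex.Im (f Q * g Q)) = (fun Q =>
      complex.Re (f Q) * complex.Im (g Q) + complex.Im (f Q) * complex.Re (g Q)).
    by apply/funext => Q; case: (f Q) (g Q) => [a b] [c d].
  by apply: measurable_funD; apply: measurable_funM.
- exists (M * N) => Q QQ; rewrite normrM rmorphM /=.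
  by rewrite ler_pM ?fM ?gN.
Qed.

Lemma tame_cstM c f : tame f -> tame (fun Q => c * f Q).
Proof. by move=> tf; apply: tameM => //; exact: tame_cst. Qed.

Lemma eq_tame f g : f =1 g -> tame f -> tame g.
Proof. by move=> /funext ->. Qed.

Lemma tame_conj f : tame f -> tame (fun Q => Num.conj (f Q)).
Proof.
move=> [f1 f2 [M fM]]; split.
- have -> : (fun Q : T => complex.Re (Num.conj (f Q))) =
      (fun Q => complex.Re (f Q)).
    by apply/funext => Q; case: (f Q).
  by [].
- have -> : (fun Q : T => complex.Im (Num.conj (f Q))) =
      (fun Q => - complex.Im (f Q)).
    by apply/funext => Q; case: (f Q).
  exact: measurable_funN.
- by exists M => Q QQ; rewrite norm_conjC fM.
Qed.

Lemma tame_entry i j : tame (fun Q => (Q i j)%:C).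
Proof.
split; [exact: measurable_coord|exact: measurable_cst|].
exists 1 => Q QQ.
by rewrite normc_def /= expr0n addr0 sqrtr_sqr lecR Orth_entry_le1.
Qed.

Lemma tame_sum (I : Type) (r : seq I) (P : pred I) (f : I -> 'M[R]_m -> R[i]) :
  (forall i, tame (f i)) -> tame (fun Q => \sum_(i <- r | P i) f i Q).
Proof.
move=> tf; elim: r => [|i r IH].
  by under [X in tame X]funext do rewrite big_nil; exact: tame_cst.
under [X in tame X]funext do rewrite big_cons.
by case: (P i) => //; exact: tameD.
Qed.

Lemma tame_mull (P : 'M[R]_m) f :
  Orth P -> tame f -> tame (fun Q => f (P *m Q)).
Proof.
move=> PP [f1 f2 [M fM]]; have mP := measurable_mulmxl P; split.
- exact: (measurableT_comp f1 mP).
- exact: (measurableT_comp f2 mP).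
- by exists M => Q QQ; apply: fM; apply/Orth_mul.
Qed.

Lemma tame_mulr (P : 'M[R]_m) f :
  Orth P -> tame f -> tame (fun Q => f (Q *m P)).
Proof.
move=> PP [f1 f2 [M fM]]; have mP := measurable_mulmxr P; split.
- exact: (measurableT_comp f1 mP).
- exact: (measurableT_comp f2 mP).
- by exists M => Q QQ; apply: fM; apply/Orth_mulr.
Qed.

Variable mu : probability T R.
Hypothesis hmu : is_haar mu.

Lemma tame_integrable f : tame f ->
  mu.-integrable (@Orth R m) (EFin \o (fun Q => complex.Re (f Q))) /\
  mu.-integrable (@Orth R m) (EFin \o (fun Q => complex.Im (f Q))).
Proof.
move=> [f1 f2 [M fM]].
have mo := measurable_Orth.
have muo : (mu (@Orth R m) < +oo)%E by rewrite hmu.1 ltry.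
split; apply: measurable_bounded_integrable => //.
- exact: measurable_funTS.
- exists M; split; first exact: num_real.
  move=> N MN Q /fM h /=; rewrite -lecR; apply: le_trans (normc_ge_Re _) _.
  by apply: le_trans h _; rewrite lecR ltW.
- exact: measurable_funTS.
- exists M; split; first exact: num_real.
  move=> N MN Q /fM h /=; rewrite -lecR.
  have := normc_ge_Re (f Q * 'i); rewrite ReiNIm normrN normrM.
  rewrite [X in _ * X]normc_def /= expr0n expr1n add0r sqrtr1 mulr1 => h'.
  by apply: le_trans h' _; apply: le_trans h _; rewrite lecR ltW.
Qed.

Lemma eq_orth_integral f g : (forall Q : 'M[R]_m, Orth Q -> f Q = g Q) ->
  orth_integral mu f = orth_integral mu g.
Proof.
by move=> fg; congr (_ +i* _); apply: eq_Rintegral => Q /set_mem/fg ->.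
Qed.

Lemma orth_integral_cst c : orth_integral mu (fun=> c) = c.
Proof.
have mo := measurable_Orth.
have E (r : R) : \int[mu]_(Q in @Orth R m) r = r.
  rewrite Rintegral_cst // [X in fine X](_ : _ = 1%E) ?mulr1 //; exact: hmu.1.
by rewrite /orth_integral !E; case: c.
Qed.

Lemma orth_integralD f g : tame f -> tame g ->
  orth_integral mu (fun Q => f Q + g Q) =
  orth_integral mu f + orth_integral mu g.
Proof.
move=> /tame_integrable[f1 f2] /tame_integrable[g1 g2].
have mo := measurable_Orth.
rewrite /orth_integral; simpc; congr (_ +i* _).
  by rewrite -RintegralD //; apply: eq_Rintegral => Q _; rewrite raddfD.
by rewrite -RintegralD //; apply: eq_Rintegral => Q _; rewrite raddfD.
Qed.

Lemma orth_integralZ c f : tame f ->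
  orth_integral mu (fun Q => c * f Q) = c * orth_integral mu f.
Proof.
have mo := measurable_Orth.
have realZ (a : R) g : tame g ->
    orth_integral mu (fun Q => a%:C * g Q) = a%:C * orth_integral mu g.
  move=> /tame_integrable[g1 g2]; rewrite /orth_integral; simpc.
  rewrite -!RintegralZl //; congr (_ +i* _); apply: eq_Rintegral => Q _;
    by case: (g Q) => x y; simpc.
have imZ g : tame g ->
    orth_integral mu (fun Q => 'i * g Q) = 'i * orth_integral mu g.
  move=> /tame_integrable[g1 g2]; rewrite /orth_integral; simpc.
  rewrite -mulN1r -RintegralZl //; congr (_ +i* _); apply: eq_Rintegral => Q _;
    by case: (g Q) => x y; simpc.
move=> tf; have tif : tame (fun Q => 'i * f Q) by exact: tame_cstM.
rewrite [c]complexE.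
rewrite (@eq_orth_integral _ (fun Q => (complex.Re c)%:C * f Q +
  (complex.Im c)%:C * ('i * f Q))); last first.
  by move=> Q _; rewrite mulrDl mulrA [_ * 'i]mulrC.
rewrite orth_integralD; [|exact: tame_cstM|exact: tame_cstM].
by rewrite !realZ // imZ // mulrDl mulrA [_ * 'i]mulrC.
Qed.

Lemma orth_integral_sum (I : Type) (r : seq I) (P : pred I)
    (f : I -> 'M[R]_m -> R[i]) : (forall i, tame (f i)) ->
  orth_integral mu (fun Q => \sum_(i <- r | P i) f i Q) =
  \sum_(i <- r | P i) orth_integral mu (f i).
Proof.
move=> tf; elim: r => [|i r IH].
  rewrite big_nil -[RHS]orth_integral_cst.
  by apply: eq_orth_integral => Q _; rewrite big_nil.
rewrite big_cons -IH; case: ifP => Pi.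
  rewrite -orth_integralD //; last exact: tame_sum.
  by apply: eq_orth_integral => Q _; rewrite big_cons Pi.
by apply: eq_orth_integral => Q _; rewrite big_cons Pi.
Qed.

Lemma Rintegral_preserving (phi : T -> T) (g : T -> R) :
  measurable_fun [set: T] phi ->
  (forall B, measurable B -> mu (phi @^-1` B) = mu B) ->
  phi @^-1` (@Orth R m) = @Orth R m ->
  measurable_fun [set: T] g ->
  mu.-integrable (@Orth R m) (EFin \o (g \o phi)) ->
  \int[mu]_(Q in @Orth R m) g (phi Q) = \int[mu]_(Q in @Orth R m) g Q.
Proof.
move=> mphi phimu phiO mg ig; congr fine.
have mo := measurable_Orth.
have mg' : measurable_fun [set: T] (EFin \o g) by exact/measurable_EFinP.
have := @integral_pushforward _ _ T T R phi mphi mu (@Orth R m) (EFin \o g) mg'.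
rewrite phiO => /(_ ig mo) /= <-.
by apply: eq_measure_integral => A mA _; exact: phimu.
Qed.

Lemma orth_integral_mull (P : 'M[R]_m) f : Orth P -> tame f ->
  orth_integral mu (fun Q => f (P *m Q)) = orth_integral mu f.
Proof.
move=> PP tf; have /tame_integrable[i1 i2] := tame_mull PP tf.
case: tf => f1 f2 _.
have pO : (mulmx P : T -> T) @^-1` (@Orth R m) = @Orth R m.
  by apply/seteqP; split=> Q /(Orth_mul _ PP).
have pm B : measurable B -> mu ((mulmx P : T -> T) @^-1` B) = mu B.
  by move=> mB; have [_ /(_ P PP B mB)[]] := hmu.
have mP := measurable_mulmxl P.
congr (_ +i* _).
  exact: (Rintegral_preserving (g := fun Q => complex.Re (f Q)) mP pm pO f1 i1).
exact: (Rintegral_preserving (g := fun Q => complex.Im (f Q)) mP pm pO f2 i2).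
Qed.

Lemma orth_integral_mulr (P : 'M[R]_m) f : Orth P -> tame f ->
  orth_integral mu (fun Q => f (Q *m P)) = orth_integral mu f.
Proof.
move=> PP tf; have /tame_integrable[i1 i2] := tame_mulr PP tf.
case: tf => f1 f2 _.
have pO : (mulmxr P : T -> T) @^-1` (@Orth R m) = @Orth R m.
  by apply/seteqP; split=> Q /(Orth_mulr _ PP).
have pm B : measurable B -> mu ((mulmxr P : T -> T) @^-1` B) = mu B.
  by move=> mB; have [_ /(_ P PP B mB)[]] := hmu.
have mP := measurable_mulmxr P.
congr (_ +i* _).
  exact: (Rintegral_preserving (g := fun Q => complex.Re (f Q)) mP pm pO f1 i1).
exact: (Rintegral_preserving (g := fun Q => complex.Im (f Q)) mP pm pO f2 i2).
Qed.

End OrthIntegral.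

(** * Products of Majorana operators *)

Lemma adjmxM (R : realType) m n p (A : 'M[R[i]]_(m, n)) (B : 'M[R[i]]_(n, p)) :
  (A *m B) ^t* = B ^t* *m A ^t*.
Proof. by rewrite trmx_mul map_mxM. Qed.

Lemma adjmxZ (R : realType) m n a (A : 'M[R[i]]_(m, n)) :
  (a *: A) ^t* = Num.conj a *: A ^t*.
Proof. by rewrite linearZ /= map_mxZ. Qed.

Lemma adjmxD (R : realType) m n (A B : 'M[R[i]]_(m, n)) :
  (A + B) ^t* = A ^t* + B ^t*.
Proof. by rewrite linearD /= map_mxD. Qed.

Lemma adjmx1 (R : realType) n : (1%:M : 'M[R[i]]_n) ^t* = 1%:M.
Proof. by rewrite trmx1 map_mx1. Qed.

Lemma mxtrace_adj (R : realType) n (A : 'M[R[i]]_n) :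
  \tr (A ^t*) = Num.conj (\tr A).
Proof. by rewrite trace_map_mx mxtrace_tr. Qed.

Lemma big_only2 (V : nmodType) (I J : finType) (F : I -> J -> V) i0 j0 :
  (forall i j, (i != i0) || (j != j0) -> F i j = 0) ->
  \sum_i \sum_j F i j = F i0 j0.
Proof.
move=> F0; rewrite (bigD1 i0) //= (bigD1 j0) //= big1 => [|j jj0]; last first.
  by rewrite F0 // jj0 orbT.
rewrite addr0 big1 ?addr0 // => i ii0.
by rewrite big1 // => j _; rewrite F0 ?ii0.
Qed.

Lemma big_setE (S : Type) (idx : S) (op : S -> S -> S) (I : finType)
    (A : {set I}) (F : I -> S) :
  \big[op/idx]_(i in A) F i = \big[op/idx]_(i <- enum A) F i.
Proof. by rewrite /enum_mem big_filter [index_enum _]unlock. Qed.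

Lemma eq0_of_signs (K : idomainType) (s s' x : K) :
  s * s = 1 -> s' * s' = 1 -> s != s' -> x = s * s' * x -> x = 0.
Proof.
move=> ss ss' nss' xE; apply: contraNeq nss' => x0.
have {}xE : s * s' = 1 by apply: (mulIf x0); rewrite mul1r -xE.
by rewrite -[s]mulr1 -ss' mulrA xE mul1r.
Qed.

Lemma card_bits n : #|bits n| = (2 ^ n)%N.
Proof. by rewrite card_ffun card_bool card_ord. Qed.

Lemma sum_signs (K : pzRingType) (T : finType) (A : {set T}) :
  \sum_(i : T) (-1) ^+ (i \in A) = #|T|%:R - #|A|%:R *+ 2 :> K.
Proof.
rewrite (bigID (mem A)) /=.
rewrite (eq_bigr (fun=> - 1)) => [|i ->]; last by rewrite expr1.
rewrite [X in _ + X](eq_bigr (fun=> 1)) => [|i /negbTE ->]; last first.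
  by rewrite expr0.
rewrite !sumr_const mulNrn -(cardC A) natrD /= mulr2n.
by rewrite opprD addrA [_%:R + _]addrC addrK addrC.
Qed.

Lemma ex_perm_imset (T : finType) (A B : {set T}) :
  #|A| = #|B| -> exists s : {perm T}, s @: A = B.
Proof.
move=> AB; pose e (X : {set T}) := enum X ++ enum (~: X).
have size_e X : size (e X) = #|T| by rewrite size_cat -!cardE cardsC.
have mem_e X x : x \in e X by rewrite mem_cat !mem_enum inE orbN.
have uniq_e X : uniq (e X).
  rewrite cat_uniq !enum_uniq /= andbT; apply/hasPn => x.
  by rewrite !mem_enum inE.
pose f x := nth x (e B) (index x (e A)).
have idx x : (index x (e A) < size (e B))%N.
  by rewrite size_e -(size_e A) index_mem.
have f_inj : injective f.
  move=> x y; rewrite /f (set_nth_default y x) // => /eqP.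
  rewrite nth_uniq // => /eqP exy.
  by rewrite -(nth_index x (mem_e A x)) exy nth_index.
exists (perm f_inj); apply/eqP; rewrite eqEcard card_imset ?AB ?leqnn ?andbT //.
  apply/fintype.subsetP => _ /imsetP[x xA ->]; rewrite permE /f /e nth_cat.
  have xi : (index x (e A) < size (enum B))%N.
    by rewrite /e index_cat mem_enum xA -cardE -AB cardE index_mem mem_enum.
  by rewrite xi -mem_enum mem_nth.
exact: perm_inj.
Qed.

Lemma big_double (T : Type) (idx : T) (op : Monoid.law idx) n (F : nat -> T) :
  \big[op/idx]_(i < n.*2) F i = \big[op/idx]_(j < n) op (F j.*2) (F j.*2.+1).
Proof.
elim: n => [|n IH]; first by rewrite !big_ord0.
by rewrite [in RHS]big_ord_recr doubleS !big_ord_recr /= IH Monoid.mulmA.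
Qed.

Lemma big_modes (T : Type) (idx : T) (op : Monoid.law idx) n
    (F : 'I_n.*2 -> T) :
  \big[op/idx]_i F i =
  \big[op/idx]_(j < n) op (F (mode_odd j)) (F (mode_even j)).
Proof.
pose f k := oapp F idx (insub k).
have fE (l : 'I_n.*2) : f l = F l by rewrite /f valK.
under eq_bigr do rewrite -fE.
rewrite big_double; apply: eq_bigr => j _.
by rewrite -!fE.
Qed.

Definition modes n (J : {set 'I_n}) : {set 'I_n.*2} :=
  @mode_odd n @: J :|: @mode_even n @: J.

Lemma mode_odd_inj n : injective (@mode_odd n).
Proof. by move=> i j [/double_inj/val_inj]. Qed.

Lemma mode_even_inj n : injective (@mode_even n).
Proof. by move=> i j [/double_inj/val_inj]. Qed.

Lemma mode_odd_even n (i j : 'I_n) : mode_odd i == mode_even j = false.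
Proof.
apply/negP => /eqP/(congr1 (odd \o val)) /=.
by rewrite !odd_double.
Qed.

Lemma mem_modes_odd n (J : {set 'I_n}) j :
  (mode_odd j \in modes J) = (j \in J).
Proof.
rewrite inE mem_imset ?orbF; last exact: mode_odd_inj.
case: imsetP => [[i _ /eqP]|]; last by rewrite orbF.
by rewrite mode_odd_even.
Qed.

Lemma mem_modes_even n (J : {set 'I_n}) j :
  (mode_even j \in modes J) = (j \in J).
Proof.
rewrite inE [X in _ || X]mem_imset ?orbF; last exact: mode_even_inj.
case: imsetP => [[i _ /eqP]|//].
by rewrite eq_sym mode_odd_even.
Qed.

Lemma card_modes n (J : {set 'I_n}) : #|modes J| = #|J|.*2.
Proof.
rewrite cardsU !card_imset; [|exact: mode_even_inj|exact: mode_odd_inj].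
rewrite addnn (_ : _ :&: _ = finset.set0) ?cards0 ?subn0 //; apply/setP => l.
rewrite !inE; apply/negP => /andP[/imsetP[i _ ->] /imsetP[j _ /eqP]].
by rewrite mode_odd_even.
Qed.

Lemma modes_inj n : injective (@modes n).
Proof.
move=> J K JK; apply/setP => j.
by rewrite -[LHS]mem_modes_odd JK mem_modes_odd.
Qed.

Lemma prod_scalemx (K : comPzRingType) m (I : Type) (r : seq I) (c : I -> K)
    (F : I -> 'M[K]_m) :
  \prod_(i <- r) (c i *: F i) = (\prod_(i <- r) c i) *: \prod_(i <- r) F i.
Proof.
elim: r => [|i r IH]; first by rewrite !big_nil scale1r.
rewrite !big_cons IH; move: (\prod_(i <- r) F i) => X.
by rewrite -[LHS]/(_ *m _) -scalemxAl -scalemxAr scalerA.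
Qed.

Section Clifford.
Variables (R : realType) (n : nat) (gamma : 'I_n.*2 -> qop R n).
Hypothesis hgamma : majorana gamma.

Notation gm := (majorana_prod gamma).

Lemma majorana_sqr i : gamma i *m gamma i = 1%:M.
Proof.
have := majorana_anticomm hgamma i i; rewrite eqxx -mulr2n => h.
have : (2 : R[i]) *: (gamma i *m gamma i) = 2 *: 1%:M.
  by rewrite scaler_nat h scale_scalar_mx mulr1.
have n2 : (2 : R[i]) != 0 by rewrite pnatr_eq0.
by move/(scalerI n2).
Qed.

Lemma majorana_swap i j : i != j ->
  gamma i *m gamma j = - (gamma j *m gamma i).
Proof.
move=> /negbTE ij; have := majorana_anticomm hgamma i j.
rewrite ij mulr0n => /eqP.
by rewrite (_ : 0%:M = 0) ?addr_eq0 ?raddf0 // => /eqP.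
Qed.

Lemma majorana_seq_swap i s :
  gamma i *m \prod_(l <- s) gamma l =
  (-1) ^+ count (predC1 i) s *: (\prod_(l <- s) gamma l *m gamma i).
Proof.
elim: s => [|j s IH]; first by rewrite big_nil mulmx1 mul1mx scale1r.
rewrite !big_cons /=; move: (\prod_(l <- s) gamma l) IH => X IH.
rewrite -mulmxE mulmxA; have [->|ij] := eqVneq j i.
  by rewrite -mulmxA {1}IH -scalemxAr mulmxA.
rewrite (@majorana_swap i j) 1?eq_sym // mulNmx -(mulmxA _ _ X) IH exprD expr1.
by rewrite mulN1r -scalemxAr scaleNr mulmxA.
Qed.

Lemma majorana_seq_unitary s :
  (\prod_(l <- s) gamma l) ^t* *m (\prod_(l <- s) gamma l) = 1%:M.
Proof.
elim: s => [|j s IH]; first by rewrite big_nil mulmx1 [LHS]adjmx1.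
rewrite !big_cons; move: (\prod_(l <- s) gamma l) IH => X IH.
rewrite -mulmxE adjmxM (majorana_herm hgamma) mulmxA.
by rewrite -(mulmxA _ (gamma j) (gamma j)) majorana_sqr mulmx1.
Qed.

Lemma majorana_prodE A : gm A = \prod_(l <- enum A) gamma l.
Proof. exact: big_setE. Qed.

Lemma majorana_prod_unitary A : (gm A) ^t* *m gm A = 1%:M.
Proof. by rewrite majorana_prodE majorana_seq_unitary. Qed.

Definition msign (i : 'I_n.*2) (A : {set 'I_n.*2}) : R[i] :=
  (-1) ^+ (#|A| + (i \in A)).

Lemma msign_sqr i A : msign i A * msign i A = 1.
Proof. by rewrite -expr2 sqrr_sign. Qed.

Lemma conj_msign i A : Num.conj (msign i A) = msign i A.
Proof. by rewrite rmorphXn rmorphN1. Qed.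

Lemma count_predC1_sign (T : finType) (i : T) (A : {set T}) :
  (-1) ^+ count (predC1 i) (enum A) = (-1) ^+ (#|A| + (i \in A)) :> R[i].
Proof.
rewrite cardE -(count_predC (pred1 i) (enum A)) count_uniq_mem ?enum_uniq //.
by rewrite mem_enum addnAC addnn exprD -mul2n exprM sqrrN !expr1n mul1r.
Qed.

Lemma majorana_prod_swap i A :
  gamma i *m gm A = msign i A *: (gm A *m gamma i).
Proof. by rewrite majorana_prodE majorana_seq_swap count_predC1_sign. Qed.

Lemma msign_inj A B : (forall i, msign i A = msign i B) -> A = B.
Proof.
move=> h.
have {}h i : odd #|A| (+) (i \in A) = odd #|B| (+) (i \in B).
  have := h i; rewrite /msign -signr_odd -[RHS]signr_odd !oddD !oddb.
  by move/signr_inj.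
have [eAB|nAB] := boolP (odd #|A| == odd #|B|).
  by apply/setP => i; move: (h i); rewrite (eqP eAB) => /addbI.
have AB : B = ~: A.
  apply/setP => i; rewrite inE; move: (h i) nAB.
  by case: (odd #|A|) (odd #|B|) (i \in A) (i \in B) => -[] [] [].
have := cardsC A; rewrite -AB card_ord => /(congr1 odd).
by rewrite oddD odd_double; move: nAB; case: (odd #|A|) (odd #|B|) => -[].
Qed.

Lemma msign_neq A B : A != B -> exists i, msign i A != msign i B.
Proof.
move=> AB; apply/existsP; rewrite -negb_forall.
apply: contraNN AB => /forallP h.
by apply/eqP/msign_inj => i; apply/eqP; rewrite -[_ == _]negbK h.
Qed.

Lemma trace_majorana_eq0 A B X :
  (forall i, gamma i *m X = msign i B *: (X *m gamma i)) ->
  A != B -> \tr ((gm A) ^t* *m X) = 0.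
Proof.
move=> hX AB.
have [i iAB] := msign_neq AB.
have hA : (gm A) ^t* *m gamma i = msign i A *: (gamma i *m (gm A) ^t*).
  rewrite -{1}(majorana_herm hgamma i) -adjmxM majorana_prod_swap adjmxZ.
  by rewrite conj_msign adjmxM (majorana_herm hgamma).
apply: (eq0_of_signs (msign_sqr i A) (msign_sqr i B) iAB).
rewrite -{1}[X]mul1mx -(majorana_sqr i) -mulmxA hX -scalemxAr -scalemxAr.
rewrite mxtraceZ !mulmxA hA -!scalemxAl mxtraceZ mulrCA mulrA.
by rewrite -!mulmxA mxtrace_mulC -!mulmxA majorana_sqr mulmx1.
Qed.

Lemma trace_majorana A B :
  \tr ((gm A) ^t* *m gm B) = 2 ^+ n *+ (A == B).
Proof.
have [->|AB] := eqVneq A B.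
  by rewrite majorana_prod_unitary mxtrace1 card_bits natrX.
by rewrite (@trace_majorana_eq0 A B) // => i; exact: majorana_prod_swap.
Qed.

Definition mcoef A X := 2 ^- n * \tr ((gm A) ^t* *m X).

Fact pow2_neq0 : (2 : R[i]) ^+ n != 0.
Proof. by rewrite expf_neq0 // pnatr_eq0. Qed.

Lemma mcoef_prod A B : mcoef A (gm B) = (A == B)%:R.
Proof. by rewrite /mcoef trace_majorana mulrnAr mulVf ?pow2_neq0. Qed.

Lemma mcoefZ A a X : mcoef A (a *: X) = a * mcoef A X.
Proof. by rewrite /mcoef -scalemxAr mxtraceZ mulrCA. Qed.

Lemma mcoef_sum A (I : Type) (r : seq I) P (F : I -> qop R n) :
  mcoef A (\sum_(i <- r | P i) F i) = \sum_(i <- r | P i) mcoef A (F i).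
Proof. by rewrite /mcoef mulmx_sumr raddf_sum mulr_sumr. Qed.

Lemma mcoef_expand A X (c : {set 'I_n.*2} -> R[i]) :
  X = \sum_B c B *: gm B -> mcoef A X = c A.
Proof.
move=> ->; rewrite mcoef_sum (bigD1 A) //= mcoefZ mcoef_prod eqxx mulr1.
rewrite big1 ?addr0 // => B BA.
by rewrite mcoefZ mcoef_prod eq_sym (negbTE BA) mulr0.
Qed.

(* The 4 ^ n orthogonal vectors [gm A] fill the space of operators, whose
   dimension is (2 ^ n) ^ 2. *)
Lemma mcoefE X : X = \sum_A mcoef A X *: gm A.
Proof.
pose G := \matrix_(i < #|{set 'I_n.*2}|) mxvec (gm (enum_val i)).
have GE (w : 'rV_#|{set 'I_n.*2}|) :
    w *m G = mxvec (\sum_A w 0 (enum_rank A) *: gm A).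
  rewrite mulmx_sum_row linear_sum /= (reindex enum_rank) /=; last first.
    exact/onW_bij/enum_rank_bij.
  by apply: eq_bigr => A _; rewrite linearZ /= rowK enum_rankK.
have freeG : row_free G.
  apply/inj_row_free => w; rewrite GE => /(canRL mxvecK); rewrite linear0 => h.
  apply/rowP => i; rewrite mxE -(enum_valK i).
  have := @mcoef_expand (enum_val i) 0 (fun A => w 0 (enum_rank A)) (esym h).
  by move=> <-; rewrite /mcoef mulmx0 mxtrace0 mulr0.
have fullG : row_full G.
  rewrite /row_full (eqP freeG) -cardsT -powersetT card_powerset cardsT.
  by rewrite card_ord card_bits -expnD addnn.
have /submxP[w hw] : (mxvec X <= G)%MS by apply: submx_full.
have XE : X = \sum_A w 0 (enum_rank A) *: gm A.
  by apply: (can_inj mxvecK); rewrite hw GE.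
rewrite {1}XE; apply: eq_bigr => A _; congr (_ *: _).
by rewrite (mcoef_expand A XE).
Qed.

Lemma conj_mcoef A X :
  Num.conj (mcoef A X) = 2 ^- n * \tr (X ^t* *m gm A).
Proof.
rewrite /mcoef rmorphM /= -mxtrace_adj adjmxM trmxCK fmorphV rmorphXn.
by rewrite rmorph_nat.
Qed.

Lemma mxtrace_adj_mcoef X Y :
  2 ^- n * \tr (X ^t* *m Y) = \sum_A Num.conj (mcoef A X) * mcoef A Y.
Proof.
rewrite {1}[Y]mcoefE mulmx_sumr raddf_sum mulr_sumr; apply: eq_bigr => A _ /=.
by rewrite conj_mcoef -scalemxAr mxtraceZ mulrCA mulrC.
Qed.

Lemma mcoef_prod_unique B X :
  (forall i, gamma i *m X = msign i B *: (X *m gamma i)) ->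
  X = mcoef B X *: gm B.
Proof.
move=> hX; rewrite {1}[X]mcoefE (bigD1 B) //= big1 ?addr0 // => A AB.
by rewrite /mcoef (trace_majorana_eq0 hX AB) mulr0 scale0r.
Qed.

Lemma sum_majorana_conj A :
  \sum_i gamma i *m gm A *m gamma i =
  ((-1) ^+ #|A| * (n.*2%:R - #|A|%:R *+ 2)) *: gm A.
Proof.
transitivity (\sum_i msign i A *: gm A).
  apply: eq_bigr => i _.
  by rewrite majorana_prod_swap -scalemxAl -mulmxA majorana_sqr mulmx1.
rewrite -scaler_suml; congr (_ *: _).
have := sum_signs R[i] A; rewrite card_ord => <-; rewrite mulr_sumr.
by apply: eq_bigr => i _; rewrite /msign exprD.
Qed.

Lemma mcoef_sum_majorana_conj B X :
  mcoef B (\sum_i gamma i *m X *m gamma i) =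
  (-1) ^+ #|B| * (n.*2%:R - #|B|%:R *+ 2) * mcoef B X.
Proof.
rewrite {1}[X]mcoefE; under eq_bigr do rewrite mulmx_sumr mulmx_suml.
rewrite exchange_big /=.
apply: (@mcoef_expand B _ (fun A =>
  (-1) ^+ #|A| * (n.*2%:R - #|A|%:R *+ 2) * mcoef A X)).
apply: eq_bigr => A _.
rewrite [_ * mcoef A X]mulrC -[in RHS]scalerA -sum_majorana_conj scaler_sumr.
by apply: eq_bigr => i _; rewrite -scalemxAr -scalemxAl.
Qed.

Lemma majorana_conj_eigen_inj a b :
  (-1) ^+ a * (n.*2%:R - a%:R *+ 2) =
    (-1) ^+ b * (n.*2%:R - b%:R *+ 2) :> R[i] ->
  a = b.
Proof.
have s0 k : (-1) ^+ k != 0 :> R[i] by rewrite signr_eq0.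
have [ab|nab] := boolP (odd a == odd b).
  rewrite -signr_odd (eqP ab) signr_odd => /(mulfI (s0 _)) /addrI.
  by move/oppr_inj; rewrite -!mulrnA => /eqP; rewrite eqr_nat eqn_mul2r => /eqP.
have -> : (-1) ^+ b = - (-1) ^+ a :> R[i].
  by rewrite -signr_odd -[in RHS]signr_odd; move: nab;
    case: (odd a) (odd b) => -[] //; rewrite ?expr0 ?expr1 ?opprK.
rewrite mulNr -mulrN => /(mulfI (s0 _)) /eqP; rewrite -subr_eq0.
have -> : n.*2%:R - a%:R *+ 2 - - (n.*2%:R - b%:R *+ 2) =
    (n.*2 * 2)%:R - ((a + b) * 2)%:R :> R[i] by rewrite !natrM natrD; ring.
rewrite subr_eq0 eqr_nat eqn_mul2r /= => /eqP /(congr1 odd).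
by rewrite odd_double oddD; move: nab; case: (odd a) (odd b) => -[].
Qed.

Definition majorana_rot (Q : 'M[R]_n.*2) (A : {set 'I_n.*2}) : qop R n :=
  \prod_(l in A) \sum_k (Q l k)%:C *: gamma k.

Notation rot := majorana_rot.

Definition rot_coef Q A B := mcoef B (rot Q A).

Lemma implements_unitary Q V : implements gamma Q V ->
  V ^t* *m V = 1%:M /\ V *m V ^t* = 1%:M.
Proof. by case=> /unitarymxP V1 _; split=> //; apply: mulmx1C. Qed.

Lemma conj_mulmx (V X Y : qop R n) : V *m V ^t* = 1%:M ->
  V ^t* *m (X *m Y) *m V = V ^t* *m X *m V *m (V ^t* *m Y *m V).
Proof. by move=> V2; rewrite !mulmxA -(mulmxA _ V (V ^t*)) V2 mulmx1. Qed.

Lemma conj_prodmx (V : qop R n) (A : {set 'I_n.*2}) (F : 'I_n.*2 -> qop R n) :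
  V ^t* *m V = 1%:M -> V *m V ^t* = 1%:M ->
  V ^t* *m (\prod_(l in A) F l) *m V = \prod_(l in A) (V ^t* *m F l *m V).
Proof.
move=> V1 V2; apply: (big_morph (fun X => V ^t* *m X *m V)) => [X Y|].
  exact: conj_mulmx.
by rewrite [_ *m 1]mulmx1 V1.
Qed.

Lemma implements_prod Q V A : implements gamma Q V ->
  V ^t* *m gm A *m V = rot Q A.
Proof.
move=> QV; have [V1 V2] := implements_unitary QV.
by rewrite conj_prodmx //; apply: eq_bigr => l _; case: QV.
Qed.

Lemma implements_rot P Q V A : implements gamma Q V ->
  V ^t* *m rot P A *m V = rot (P *m Q) A.
Proof.
move=> QV; have [V1 V2] := implements_unitary QV.
rewrite conj_prodmx //; apply: eq_bigr => l _; case: QV => _ QV.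
rewrite mulmx_sumr mulmx_suml.
transitivity (\sum_k \sum_j ((P l k)%:C * (Q k j)%:C) *: gamma j).
  apply: eq_bigr => k _; rewrite -scalemxAr -scalemxAl QV scaler_sumr.
  by apply: eq_bigr => j _; rewrite scalerA.
rewrite exchange_big; apply: eq_bigr => j _; rewrite -scaler_suml mxE.
by rewrite rmorph_sum; congr (_ *: _); apply: eq_bigr => k _; rewrite rmorphM.
Qed.

Lemma orth_cols (Q : 'M[R]_n.*2) j l : Orth Q ->
  \sum_k Q k j * Q k l = (j == l)%:R.
Proof.
move=> QQ; have := congr1 (fun M : 'M[R]_n.*2 => M j l) (mulmx1C QQ).
by rewrite !mxE => <-; apply: eq_bigr => k _; rewrite mxE.
Qed.

Lemma sum_orth_conj (Q : 'M[R]_n.*2) X : Orth Q ->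
  \sum_k (\sum_i (Q k i)%:C *: gamma i) *m X *m (\sum_l (Q k l)%:C *: gamma l)
  = \sum_i gamma i *m X *m gamma i.
Proof.
move=> QQ.
transitivity (\sum_i \sum_l \sum_k
    (Q k i * Q k l)%:C *: (gamma i *m X *m gamma l)).
  under [RHS]eq_bigr do rewrite exchange_big.
  rewrite [RHS]exchange_big; apply: eq_bigr => k _.
  rewrite !mulmx_suml; apply: eq_bigr => i _.
  rewrite mulmx_sumr; apply: eq_bigr => l _.
  by rewrite -!scalemxAl -scalemxAr scalerA rmorphM.
apply: eq_bigr => i _; rewrite (bigD1 i) //= -scaler_suml -rmorph_sum.
rewrite orth_cols // eqxx scale1r big1 ?addr0 // => l li.
by rewrite -scaler_suml -rmorph_sum orth_cols // eq_sym (negbTE li) scale0r.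
Qed.

Lemma implements_adj (Q : 'M[R]_n.*2) V : Orth Q -> implements gamma Q V ->
  implements gamma Q^T (V ^t*).
Proof.
move=> QQ QV; have [V1 V2] := implements_unitary QV; case: QV => _ QV.
split=> [|j]; first by apply/unitarymxP; rewrite trmxCK.
rewrite trmxCK.
have -> : gamma j = \sum_k \sum_l (Q k j * Q k l)%:C *: gamma l.
  rewrite exchange_big (bigD1 j) //= -scaler_suml -rmorph_sum.
  rewrite orth_cols // eqxx scale1r big1 ?addr0 // => l lj.
  by rewrite -scaler_suml -rmorph_sum orth_cols // eq_sym (negbTE lj) scale0r.
rewrite mulmx_sumr mulmx_suml; apply: eq_bigr => k _.
under eq_bigr do rewrite rmorphM -scalerA.
rewrite -scaler_sumr -QV -scalemxAr -scalemxAl mxE.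
by rewrite !mulmxA V2 mul1mx -mulmxA V2 mulmx1.
Qed.

Lemma mcoef_conj Q V A B : implements gamma Q V ->
  mcoef A (V *m gm B *m V ^t*) = Num.conj (rot_coef Q A B).
Proof.
move=> QV; rewrite conj_mcoef -(implements_prod A QV) !adjmxM trmxCK.
by rewrite /mcoef !mulmxA mxtrace_mulC !mulmxA.
Qed.

Lemma sum_rot_coef Q V A : implements gamma Q V ->
  \sum_B rot_coef Q A B * Num.conj (rot_coef Q A B) = 1.
Proof.
move=> QV; have [V1 V2] := implements_unitary QV.
under eq_bigr do rewrite mulrC.
rewrite -mxtrace_adj_mcoef -(implements_prod A QV) !adjmxM trmxCK !mulmxA.
rewrite -(mulmxA _ V) V2 mulmx1 -(mulmxA _ _ (gm A)) majorana_prod_unitary.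
by rewrite mulmx1 V1 mxtrace1 card_bits natrX mulVf ?pow2_neq0.
Qed.

Lemma rot_coef_degree (Q : 'M[R]_n.*2) V (A B : {set 'I_n.*2}) :
  Orth Q -> implements gamma Q V -> #|A| != #|B| -> rot_coef Q A B = 0.
Proof.
move=> QQ QV AB; have [V1 V2] := implements_unitary QV.
have h : \sum_i gamma i *m rot Q A *m gamma i =
    ((-1) ^+ #|A| * (n.*2%:R - #|A|%:R *+ 2)) *: rot Q A.
  rewrite -(implements_prod A QV) -(sum_orth_conj _ QQ) scalemxAl scalemxAr.
  rewrite -sum_majorana_conj mulmx_sumr mulmx_suml; apply: eq_bigr => k _.
  by case: QV => _ /(_ k) <-; rewrite !conj_mulmx.
have := mcoef_sum_majorana_conj B (rot Q A); rewrite h mcoefZ.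
have [//|nz /(mulIf nz)/majorana_conj_eigen_inj/eqP] :=
  eqVneq (rot_coef Q A B) 0.
by rewrite (negbTE AB).
Qed.

Definition axis_refl (i : 'I_n.*2) : 'M[R]_n.*2 :=
  diag_mx (\row_j (-1) ^+ (j != i)).

Lemma axis_refl_orth i : Orth (axis_refl i).
Proof.
rewrite /Orth /= tr_diag_mx mulmx_diag; apply/matrixP => j k.
by rewrite !mxE -expr2 sqrr_sign.
Qed.

Lemma implements_axis_refl i : implements gamma (axis_refl i) (gamma i).
Proof.
split=> [|j]; first by apply/unitarymxP; rewrite majorana_herm ?majorana_sqr.
rewrite (majorana_herm hgamma) (bigD1 j) //= big1 => [|k kj]; last first.
  by rewrite !mxE [j == k]eq_sym (negbTE kj) mulr0n scale0r.
rewrite addr0 !mxE eqxx; have [->|ji] := eqVneq j i.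
  by rewrite -mulmxA majorana_sqr mulmx1 scale1r.
rewrite majorana_swap 1?eq_sym // mulNmx -mulmxA majorana_sqr mulmx1.
by rewrite rmorphN1 scaleN1r.
Qed.

Lemma rot_axis_refl i A : rot (axis_refl i) A = msign i A *: gm A.
Proof.
rewrite -(implements_prod A (implements_axis_refl i)) (majorana_herm hgamma).
by rewrite majorana_prod_swap -scalemxAl -mulmxA majorana_sqr mulmx1.
Qed.

Lemma rot_coef_reflL i Q V A B : implements gamma Q V ->
  rot_coef (axis_refl i *m Q) A B = msign i A * rot_coef Q A B.
Proof.
move=> QV; rewrite /rot_coef -(implements_rot _ A QV) rot_axis_refl.
by rewrite -scalemxAr -scalemxAl mcoefZ (implements_prod A QV).
Qed.

Lemma rot_coefMr (P Q : 'M[R]_n.*2) W A B : Orth P -> implements gamma P W ->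
  rot_coef (Q *m P) A B = 2 ^- n * \tr ((rot P^T B) ^t* *m rot Q A).
Proof.
move=> PP PW; rewrite /rot_coef -(implements_rot Q A PW).
rewrite -(implements_prod B (implements_adj PP PW)) /mcoef !adjmxM !trmxCK.
by rewrite !mulmxA mxtrace_mulC !mulmxA.
Qed.

Lemma rot_coef_reflR i Q A B :
  rot_coef (Q *m axis_refl i) A B = msign i B * rot_coef Q A B.
Proof.
rewrite (rot_coefMr _ _ _ (@axis_refl_orth i) (implements_axis_refl i)).
rewrite tr_diag_mx rot_axis_refl adjmxZ conj_msign -scalemxAl mxtraceZ.
by rewrite mulrCA.
Qed.

(* Up to a phase, an operator is determined by its commutation signs with the
   gamma_i, so the sign of the permutation never has to be computed. *)
Lemma rot_perm s A : exists2 z : R[i],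
  z * Num.conj z = 1 & rot (perm_mx s) A = z *: gm (s @: A).
Proof.
have E : rot (perm_mx s) A = \prod_(l <- map s (enum A)) gamma l.
  rewrite big_map -big_setE; apply: eq_bigr => l _.
  rewrite (bigD1 (s l)) //= !mxE eqxx scale1r big1 ?addr0 // => k ksl.
  by rewrite !mxE eq_sym (negbTE ksl) scale0r.
have sw i : gamma i *m rot (perm_mx s) A =
    msign i (s @: A) *: (rot (perm_mx s) A *m gamma i).
  rewrite E majorana_seq_swap -(permKV s i) count_map.
  rewrite (eq_count (a2 := predC1 ((s^-1)%g i))) => [|j]; last first.
    by rewrite /= (inj_eq perm_inj).
  by rewrite count_predC1_sign /msign card_imset ?mem_imset //; exact: perm_inj.
set z := mcoef (s @: A) (rot (perm_mx s) A).
exists z; last exact: mcoef_prod_unique.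
have : (rot (perm_mx s) A)^t* *m rot (perm_mx s) A = 1%:M.
  by rewrite E majorana_seq_unitary.
rewrite (mcoef_prod_unique sw) adjmxZ -scalemxAl -scalemxAr scalerA.
rewrite majorana_prod_unitary -/z => h.
have := congr1 mxtrace h; rewrite mxtraceZ mxtrace1 card_bits natrX => h'.
by apply: (mulIf pow2_neq0); rewrite mulrC [z * _]mulrC mulrC h' mul1r.
Qed.

Lemma perm_mx_orth (s : {perm 'I_n.*2}) : Orth (perm_mx s : 'M[R]_n.*2).
Proof. by rewrite /Orth /= tr_perm_mx -perm_mxM mulgV perm_mx1. Qed.

Lemma rot_coef_permR s B W : implements gamma (perm_mx s^-1) W ->
  exists2 z : R[i], z * Num.conj z = 1 &
    forall Q A, rot_coef (Q *m perm_mx s^-1) A B = z * rot_coef Q A (s @: B).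
Proof.
move=> sW; have [z z1 Ez] := rot_perm s B; exists (Num.conj z) => [|Q A].
  by rewrite conjCK mulrC.
rewrite (rot_coefMr _ _ _ (@perm_mx_orth _) sW) tr_perm_mx invgK Ez adjmxZ.
by rewrite -scalemxAl mxtraceZ mulrCA.
Qed.

Definition ketbra_coef (x : bits n) (J : {set 'I_n}) : R[i] :=
  2 ^- n * \prod_(j in J) - ('i * (-1) ^+ x j).

Lemma majorana_prod_modes J :
  gm (modes J) = \prod_(j in J) (gamma (mode_odd j) *m gamma (mode_even j)).
Proof.
rewrite /majorana_prod big_mkcond big_modes [RHS]big_mkcond /=.
apply: eq_bigr => j _; rewrite mem_modes_odd mem_modes_even.
by case: ifP => // _; rewrite mulr1.
Qed.

Lemma ketbraE x : ketbra R x = \sum_J ketbra_coef x J *: gm (modes J).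
Proof.
rewrite (majorana_ketbra hgamma).
pose c j : R[i] := - ('i * (-1) ^+ x j).
pose G j := gamma (mode_odd j) *m gamma (mode_even j).
transitivity (\prod_j (2^-1 *: (c j *: G j) + 2^-1 *: 1%:M)).
  by apply: eq_bigr => j _; rewrite scaleNr -scalerDr addrC.
rewrite bigA_distr; apply: eq_bigr => J _.
transitivity (\prod_j (2^-1 *: ((if j \in J then c j else 1) *:
    (if j \in J then G j else 1)))).
  by apply: eq_bigr => j _; case: (j \in J); [|rewrite scale1r].
rewrite !prod_scalemx scalerA prodr_const card_ord -!big_mkcond.
by rewrite majorana_prod_modes exprVn.
Qed.

Lemma mcoef_ketbra x A :
  mcoef A (ketbra R x) = \sum_(J | modes J == A) ketbra_coef x J.
Proof.
rewrite ketbraE mcoef_sum [RHS]big_mkcond; apply: eq_bigr => J _.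
rewrite mcoefZ mcoef_prod [A == _]eq_sym.
by case: ifP => _; rewrite ?mulr1 ?mulr0.
Qed.

Lemma mcoef_ketbra_odd x (A : {set 'I_n.*2}) :
  odd #|A| -> mcoef A (ketbra R x) = 0.
Proof.
move=> oA; rewrite mcoef_ketbra big_pred0 // => J.
apply: contraTF oA => /eqP <-.
by rewrite card_modes odd_double.
Qed.

Lemma ketbra_coef_norm x J :
  Num.conj (ketbra_coef x J) * ketbra_coef x J = 2 ^- n * 2 ^- n.
Proof.
rewrite /ketbra_coef rmorphM /= fmorphV rmorphXn rmorph_nat mulrACA.
rewrite rmorph_prod -big_split /= big1 ?mulr1 // => j _.
rewrite !rmorphN !rmorphM !rmorphXn rmorphN1 mulrNN mulrACA -expr2 sqrr_sign.
by rewrite mulr1; simpc.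
Qed.

Lemma sum_mcoef_ketbra x k :
  \sum_(A : {set 'I_n.*2} | #|A| == k.*2)
    Num.conj (mcoef A (ketbra R x)) * mcoef A (ketbra R x) =
  'C(n, k)%:R * (2 ^- n * 2 ^- n).
Proof.
transitivity (\sum_(A : {set 'I_n.*2} | #|A| == k.*2)
    \sum_(J : {set 'I_n} | modes J == A) (2 ^- n * 2 ^- n : R[i])).
  apply: eq_bigr => A _; rewrite mcoef_ketbra.
  have [J JA|noJ] := pickP (fun J => modes J == A).
    have JE K : (modes K == A) = (K == J).
      by rewrite -(eqP JA) (inj_eq (@modes_inj n)).
    by rewrite !(big_pred1 J) // ketbra_coef_norm.
  by rewrite !big_pred0 // mulr0.
rewrite (exchange_big_dep xpredT) //=.
rewrite (eq_bigr (fun J : {set 'I_n} =>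
  if #|J| == k then 2 ^- n * 2 ^- n else 0)) => [|J _].
  rewrite -big_mkcond sumr_const mulr_natl; congr (_ *+ _).
  rewrite -[in RHS](card_ord n) -card_draws cardsE.
  exact: eq_card.
rewrite -[#|J| == k](inj_eq double_inj) -card_modes; case: ifP => Jk.
  by rewrite (big_pred1 (modes J)) // => A /=; rewrite [RHS]eq_sym andbC;
    case: eqP => // <-.
rewrite big_pred0 // => A; rewrite andbC.
by case: eqP => //= <-.
Qed.

End Clifford.

(** * The shadow channel *)

Section Twirl.
Variables (R : realType) (n : nat) (gamma : 'I_n.*2 -> qop R n).
Hypothesis hgamma : majorana gamma.
Variable mu : probability (borel_mx R n.*2) R.
Hypothesis hmu : is_haar mu.
Variable U : 'M[R]_n.*2 -> qop R n.
Hypothesis hU : forall Q : 'M[R]_n.*2, Orth Q -> implements gamma Q (U Q).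

Notation gm := (majorana_prod gamma).
Notation rcf := (rot_coef gamma).

Lemma tame_majorana_rot A i j : tame (fun Q => majorana_rot gamma Q A i j).
Proof.
have -> : (fun Q => majorana_rot gamma Q A i j) = (fun Q =>
    (\prod_(l <- enum A) \sum_k (Q l k)%:C *: gamma k) i j).
  by apply/funext => Q; rewrite -big_setE.
elim: (enum A) i => [|l s IH] i.
  apply: (@eq_tame _ _ (fun=> (1 : qop R n) i j)) => [Q|]; last exact: tame_cst.
  by rewrite big_nil.
apply: (@eq_tame _ _ (fun Q => \sum_k' (\sum_k (Q l k)%:C * gamma k i k') *
    (\prod_(l <- s) \sum_k (Q l k)%:C *: gamma k) k' j)) => [Q|].
  rewrite big_cons; move: (\prod_(l <- s) _) => X.
  rewrite -[in RHS]mulmxE mxE; apply: eq_bigr => k' _; congr (_ * _).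
  by rewrite summxE; apply: eq_bigr => k _; rewrite mxE.
apply: tame_sum => k'; apply: tameM (IH k'); apply: tame_sum => k.
by apply: tameM; [exact: tame_entry|exact: tame_cst].
Qed.

Lemma tame_rot_coef A B : tame (fun Q => rcf Q A B).
Proof.
apply: (@eq_tame _ _ (fun Q => 2 ^- n * \sum_i \sum_k
   ((gm B) ^t* i k * majorana_rot gamma Q A k i))) => [Q|].
  by congr (_ * _); apply: eq_bigr => i _; rewrite mxE.
apply: tame_cstM; apply: tame_sum => i; apply: tame_sum => k.
exact/tame_cstM/tame_majorana_rot.
Qed.

Definition rot_corr A B C D (Q : 'M[R]_n.*2) :=
  Num.conj (rcf Q A B) * rcf Q C D.

Lemma tame_rot_corr A B C D : tame (rot_corr A B C D).
Proof. by apply: tameM; [apply: tame_conj|]; exact: tame_rot_coef. Qed.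

Lemma twirl_neql A B C D : A != C -> orth_integral mu (rot_corr A B C D) = 0.
Proof.
case/(@msign_neq R n)=> i ni.
apply: (eq0_of_signs _ _ ni); rewrite ?msign_sqr //.
rewrite -{1}(orth_integral_mull hmu (@axis_refl_orth R n i)); last first.
  exact: tame_rot_corr.
rewrite -(orth_integralZ hmu); last exact: tame_rot_corr.
apply: eq_orth_integral => Q /hU QU.
rewrite /rot_corr !(rot_coef_reflL hgamma _ _ _ QU) rmorphM /= conj_msign.
exact: mulrACA.
Qed.

Lemma twirl_neqr A B C D : B != D -> orth_integral mu (rot_corr A B C D) = 0.
Proof.
case/(@msign_neq R n)=> i ni.
apply: (eq0_of_signs _ _ ni); rewrite ?msign_sqr //.
rewrite -{1}(orth_integral_mulr hmu (@axis_refl_orth R n i)); last first.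
  exact: tame_rot_corr.
rewrite -(orth_integralZ hmu); last exact: tame_rot_corr.
apply: eq_orth_integral => Q _.
by rewrite /rot_corr !(rot_coef_reflR hgamma) rmorphM /= conj_msign mulrACA.
Qed.

Lemma twirl_imset (s : {perm 'I_n.*2}) A B :
  orth_integral mu (rot_corr A B A B) =
  orth_integral mu (rot_corr A (s @: B) A (s @: B)).
Proof.
have Os := @perm_mx_orth R n (s^-1)%g.
apply: (etrans (esym (orth_integral_mulr hmu Os (tame_rot_corr A B A B)))).
have [z z1 zE] := rot_coef_permR hgamma B (hU Os).
apply: eq_orth_integral => Q _.
by rewrite /rot_corr !zE rmorphM mulrACA [_ * z]mulrC z1 mul1r.
Qed.

Lemma twirl_diag A B :
  orth_integral mu (rot_corr A B A B) = (#|A| == #|B|)%:R / 'C(n.*2, #|A|)%:R.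
Proof.
have [AB|AB] := eqVneq #|A| #|B|; last first.
  rewrite mul0r -(orth_integral_cst hmu 0); apply: eq_orth_integral => Q QQ.
  by rewrite /rot_corr (rot_coef_degree hgamma QQ (hU QQ) AB) mulr0.
have {B AB} -> : orth_integral mu (rot_corr A B A B) =
    orth_integral mu (rot_corr A A A A).
  by have [s <-] := ex_perm_imset AB; exact/esym/twirl_imset.
have : \sum_B orth_integral mu (rot_corr A B A B) = 1.
  rewrite -(orth_integral_sum hmu); last by move=> B; exact: tame_rot_corr.
  rewrite -(orth_integral_cst hmu 1); apply: eq_orth_integral => Q /hU QU.
  by rewrite -(sum_rot_coef hgamma A QU); apply: eq_bigr => B _; rewrite mulrC.
rewrite (bigID (fun B : {set 'I_n.*2} => #|B| == #|A|)) /=.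
rewrite [X in _ + X]big1 => [|B /negbTE AB]; last first.
  rewrite -(orth_integral_cst hmu 0); apply: eq_orth_integral => Q QQ.
  by rewrite /rot_corr (rot_coef_degree hgamma QQ (hU QQ)) ?mulr0 // eq_sym AB.
rewrite addr0 (eq_bigr (fun=> orth_integral mu (rot_corr A A A A))); last first.
  move=> B /eqP AB; have [s <-] := ex_perm_imset (esym AB).
  exact/esym/twirl_imset.
rewrite sumr_const; have := card_draws 'I_n.*2 #|A|.
rewrite cardsE card_ord => dr h.
have nz : 'C(n.*2, #|A|)%:R != 0 :> R[i].
  by rewrite pnatr_eq0 -lt0n bin_gt0 -[leqRHS]card_ord; exact: max_card.
apply: (mulIf nz); rewrite (divfK nz).
by rewrite mulr_natr -dr -h; congr (_ *+ _); exact: eq_card.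
Qed.

Lemma twirl A B C D : orth_integral mu (rot_corr A B C D) =
  ((A == C) && (B == D) && (#|A| == #|B|))%:R / 'C(n.*2, #|A|)%:R.
Proof.
have [<-|AC] := eqVneq A C; last by rewrite twirl_neql // mul0r.
have [<-|BD] := eqVneq B D; last by rewrite twirl_neqr // mul0r.
exact: twirl_diag.
Qed.

End Twirl.

Section HermitianPreserving.
Variables (R : realType) (N : nat) (L : {linear 'M[R[i]]_N -> 'M[R[i]]_N}).
Hypothesis hCP : completely_positive L.

Lemma cp_psd (X : 'M[R[i]]_N) : psdmx X -> psdmx (L X).
Proof.
move=> pX v.
have := hCP (m := 1) (X := \mxblock_(i < 1, j < 1) X).
rewrite /ampliation => h.
have {}h : psdmx (\mxblock_(i < 1, j < 1) L X).
  have -> : \mxblock_(i < 1, j < 1) L X = \mxblock_(i < 1, j < 1)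
     L (submxblock (\mxblock_(i < 1, j < 1) X) i j).
    by apply: eq_mxblock => i j; rewrite mxblockK.
  apply: h => w; rewrite -[w]submxrowK mul_mxrow_mxblock.
  have -> : (\mxrow_(j < 1) submxrow w j) ^t* =
      \mxcol_(j < 1) (submxrow w j) ^t*.
    by apply/matrixP => i j; rewrite !mxE.
  by rewrite mul_mxrow_mxcol big_ord1 big_ord1; exact: pX.
have := h (\mxrow_(j < 1) v); rewrite mul_mxrow_mxblock.
have -> : (\mxrow_(j < 1) v) ^t* = \mxcol_(j < 1) v ^t*.
  by apply/matrixP => i j; rewrite !mxE.
by rewrite mul_mxrow_mxcol big_ord1 big_ord1.
Qed.

Lemma psd_gram M (B : 'M[R[i]]_(N, M)) : psdmx (B *m B ^t*).
Proof.
move=> v; rewrite mulmxA -mulmxA -adjmxM mxE; apply: sumr_ge0 => k _.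
by rewrite !mxE mul_conjC_ge0.
Qed.

Lemma psd_diag_Im (X : 'M[R[i]]_N) i : psdmx X -> complex.Im (X i i) = 0.
Proof.
move=> /(_ (delta_mx 0 i)) /ger0_Im.
by rewrite -rowE trmx_delta map_delta_mx -colE !mxE.
Qed.

Lemma Im_entry_sub (X Y Z : 'M[R[i]]_N) i : X - Y = 4%:R *: Z ->
  complex.Im (X i i) = 0 -> complex.Im (Y i i) = 0 -> complex.Im (Z i i) = 0.
Proof.
move=> /(congr1 (fun M : 'M[R[i]]_N => M i i)); rewrite !mxE.
rewrite (_ : 4%:R = (4%:R : R)%:C) ?rmorph_nat //.
case: (X i i) (Y i i) (Z i i) => [a b] [c d] [x y]; simpc => -[_ /= h] b0 d0.
by move: h; rewrite b0 d0 => h; lra.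
Qed.

(* H = ((H + 1)^2 - (H - 1)^2) / 4 is a difference of positive matrices. *)
Lemma cp_herm_Im (H : 'M[R[i]]_N) i : H ^t* = H -> complex.Im (L H i i) = 0.
Proof.
move=> hH; pose B s : 'M[R[i]]_N := H + s *: 1%:M.
have BB s : Num.conj s = s -> psdmx (B s *m B s).
  move=> ss; rewrite -{2}[B s](_ : (B s) ^t* = _); first exact: psd_gram.
  by rewrite /B adjmxD adjmxZ adjmx1 hH ss.
have B1 := psd_diag_Im i (cp_psd (BB 1 (rmorph1 _))).
have B2 := psd_diag_Im i (cp_psd (BB (-1) (rmorphN1 _))).
have E : L (B 1 *m B 1) - L (B (-1) *m B (-1)) = 4%:R *: L H.
  rewrite -linearB -linearZ /B scale1r scaleN1r; congr (L _).
  rewrite !mulmxDl !mulmxDr !mulmx1 !mul1mx !(mulmxN, mulNmx, mulmx1, mul1mx).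
  by apply/matrixP => j k; rewrite !mxE; ring.
exact: Im_entry_sub E B1 B2.
Qed.

End HermitianPreserving.

Section Components.
Variables (R : realType) (n : nat) (gamma : 'I_n.*2 -> qop R n).
Hypothesis hgamma : majorana gamma.

Notation gm := (majorana_prod gamma).
Notation mcf := (mcoef gamma).

Lemma herm_component A X : X ^t* = X -> (mcf A X *: gm A) ^t* = mcf A X *: gm A.
Proof.
move=> hX; pose z := mcf A ((gm A) ^t*).
have gz : (gm A) ^t* = z *: gm A.
  apply: (mcoef_prod_unique hgamma) => i.
  rewrite -{1}(majorana_herm hgamma i) -adjmxM.
  rewrite -[gm A *m gamma i](scale1r _) -(msign_sqr R i A) -scalerA.
  rewrite -(majorana_prod_swap hgamma) adjmxZ conj_msign adjmxM.
  by rewrite (majorana_herm hgamma).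
have gz' : gm A = Num.conj z *: (gm A) ^t* by rewrite -adjmxZ -gz trmxCK.
have cE : Num.conj (mcf A X) = Num.conj z * mcf A X.
  rewrite conj_mcoef hX mxtrace_mulC {1}gz' -scalemxAl mxtraceZ mulrCA.
  by rewrite /mcoef.
by rewrite adjmxZ cE [_ * mcf A X]mulrC -[LHS]scalerA -gz'.
Qed.

Lemma proj_degreeE k A : proj_degree gamma k A =
  \sum_(S : {set 'I_n.*2} | #|S| == k) mcf S A *: gm S.
Proof.
by rewrite /proj_degree scaler_sumr; apply: eq_bigr => S _; rewrite scalerA.
Qed.

Lemma sum_even_degree (F : {set 'I_n.*2} -> qop R n) (f : nat -> R[i]) :
  (forall k, odd k -> f k = 0) ->
  \sum_(S : {set 'I_n.*2}) f #|S| *: F S =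
  \sum_(k < n.+1) f k.*2 *: \sum_(S : {set 'I_n.*2} | #|S| == k.*2) F S.
Proof.
move=> f0.
under [RHS]eq_bigr do rewrite scaler_sumr big_mkcond.
rewrite exchange_big; apply: eq_bigr => S _.
have [oS|eS] := boolP (odd #|S|).
  rewrite f0 // scale0r big1 // => k _; case: eqP => // Sk.
  by rewrite Sk odd_double in oS.
have [k0 SE] : exists k0 : 'I_n.+1, #|S| = k0.*2.
  have := half_leq (max_card (mem S)); rewrite card_ord half_double -ltnS => Sn.
  by exists (Ordinal Sn); rewrite /= -[LHS]odd_double_half (negbTE eS).
rewrite (bigD1 k0) //= SE eqxx big1 ?addr0 // => k kk0.
by case: eqP => // /double_inj/val_inj k0k; rewrite k0k eqxx in kk0.
Qed.

End Components.

Section Channel.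
Variables (R : realType) (n : nat) (gamma : 'I_n.*2 -> qop R n).
Hypothesis hgamma : majorana gamma.
Variable mu : probability (borel_mx R n.*2) R.
Hypothesis hmu : is_haar mu.
Variable U : 'M[R]_n.*2 -> qop R n.
Hypothesis hU : forall Q : 'M[R]_n.*2, Orth Q -> implements gamma Q (U Q).
Variable L : {linear qop R n -> qop R n}.

Notation gm := (majorana_prod gamma).
Notation mcf := (mcoef gamma).
Notation rcf := (rot_coef gamma).

Definition shadow_summand (A : qop R n) (Q : 'M[R]_n.*2) : qop R n :=
  \sum_(x : bits n) expval x (noisy_circuit L U Q A) *: rotated_ketbra U Q x.

Lemma circuitE (Q : 'M[R]_n.*2) A x : Orth Q ->
  expval x (noisy_circuit L U Q A) =
  \sum_S \sum_C (mcf S A * expval x (L (gm C))) * Num.conj (rcf Q C S).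
Proof.
move=> /hU QU; rewrite /noisy_circuit.
have -> : U Q *m A *m (U Q) ^t* =
    \sum_S \sum_C (mcf S A * Num.conj (rcf Q C S)) *: gm C.
  rewrite {1}[A](mcoefE hgamma) mulmx_sumr mulmx_suml; apply: eq_bigr => S _.
  rewrite -scalemxAr -scalemxAl [U Q *m gm S *m _](mcoefE hgamma) scaler_sumr.
  by apply: eq_bigr => C _; rewrite (mcoef_conj _ _ QU) scalerA.
rewrite /expval linear_sum summxE; apply: eq_bigr => S _.
rewrite linear_sum summxE; apply: eq_bigr => C _.
by rewrite linearZ mxE mulrAC.
Qed.

Lemma rotatedE (Q : 'M[R]_n.*2) x : Orth Q ->
  rotated_ketbra U Q x =
  \sum_D \sum_B (mcf D (ketbra R x) * rcf Q D B) *: gm B.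
Proof.
move=> /hU QU; rewrite /rotated_ketbra {1}[ketbra R x](mcoefE hgamma).
rewrite mulmx_sumr mulmx_suml; apply: eq_bigr => D _.
rewrite -scalemxAr -scalemxAl (implements_prod D QU).
rewrite [majorana_rot gamma Q D](mcoefE hgamma) scaler_sumr.
by apply: eq_bigr => B _; rewrite scalerA.
Qed.

Definition shadow_poly A i j (Q : 'M[R]_n.*2) : R[i] :=
  \sum_x \sum_S \sum_C \sum_D \sum_B
    (mcf S A * expval x (L (gm C)) * (mcf D (ketbra R x) * gm B i j)) *
    rot_corr gamma C S D B Q.

Lemma shadow_summandE (Q : 'M[R]_n.*2) A i j : Orth Q ->
  shadow_summand A Q i j = shadow_poly A i j Q.
Proof.
move=> QQ; rewrite summxE; apply: eq_bigr => x _.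
rewrite mxE (circuitE _ _ QQ) mulr_suml; apply: eq_bigr => S _.
rewrite mulr_suml; apply: eq_bigr => C _.
rewrite (rotatedE _ QQ) summxE mulr_sumr; apply: eq_bigr => D _.
rewrite summxE mulr_sumr; apply: eq_bigr => B _.
by rewrite mxE /rot_corr; ring.
Qed.

Lemma tame_shadow_poly A i j : tame (shadow_poly A i j).
Proof.
do 5![apply: tame_sum => ?]; apply: tame_cstM; exact: tame_rot_corr.
Qed.

Definition shadow_coef (k : nat) : R[i] :=
  'C(n.*2, k)%:R^-1 * \sum_(C : {set 'I_n.*2} | #|C| == k)
    \sum_x expval x (L (gm C)) * mcf C (ketbra R x).

Lemma shadow_channelE A :
  shadow_channel mu L U A =
  \sum_(S : {set 'I_n.*2}) shadow_coef #|S| *: (mcf S A *: gm S).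
Proof.
apply/matrixP => i j; rewrite mxE.
rewrite (eq_orth_integral _ (g := shadow_poly A i j)); last first.
  by move=> Q; exact: shadow_summandE.
have tc := tame_rot_corr gamma.
have tcM c C S D B : tame (fun Q => c * rot_corr gamma C S D B Q).
  exact: tame_cstM.
transitivity (\sum_x \sum_S \sum_C \sum_D \sum_B
    (mcf S A * expval x (L (gm C)) * (mcf D (ketbra R x) * gm B i j)) *
    orth_integral mu (rot_corr gamma C S D B)).
  rewrite (orth_integral_sum hmu) => [|x]; last by do 4![apply: tame_sum => ?].
  apply: eq_bigr => x _.
  rewrite (orth_integral_sum hmu) => [|S]; last by do 3![apply: tame_sum => ?].
  apply: eq_bigr => S _.
  rewrite (orth_integral_sum hmu) => [|C]; last by do 2![apply: tame_sum => ?].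
  apply: eq_bigr => C _.
  rewrite (orth_integral_sum hmu) => [|D]; last by do 1![apply: tame_sum => ?].
  apply: eq_bigr => D _.
  rewrite (orth_integral_sum hmu) => [|B]; last by [].
  by apply: eq_bigr => B _; rewrite (orth_integralZ hmu).
transitivity (\sum_x \sum_S \sum_C
    (mcf S A * expval x (L (gm C)) * (mcf C (ketbra R x) * gm S i j)) *
    ((#|C| == #|S|)%:R / 'C(n.*2, #|C|)%:R)).
  apply: eq_bigr => x _; apply: eq_bigr => S _; apply: eq_bigr => C _.
  rewrite (big_only2 (i0 := C) (j0 := S)) => [|D B].
    by rewrite (twirl hgamma hmu hU) !eqxx.
  rewrite (twirl hgamma hmu hU) [C == D]eq_sym [S == B]eq_sym -negb_and.
  by move=> /negbTE ->; rewrite mul0r mulr0.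
rewrite exchange_big summxE; apply: eq_bigr => S _.
rewrite !mxE /shadow_coef -mulrA mulr_suml mulr_sumr exchange_big /=.
rewrite [RHS]big_mkcond; apply: eq_bigr => C _.
case: eqP => [->|_]; last by rewrite big1 // => x _; rewrite mul0r mulr0.
rewrite mulr1n mul1r mulr_suml mulr_sumr; apply: eq_bigr => x _.
by rewrite mulrC [mcf S A * _]mulrC mulrACA.
Qed.

Lemma shadow_coef_odd k : odd k -> shadow_coef k = 0.
Proof.
move=> ok; rewrite /shadow_coef big1 ?mulr0 // => C /eqP Ck.
by apply: big1 => x _; rewrite (mcoef_ketbra_odd hgamma) ?mulr0 ?Ck.
Qed.

Lemma ketbra_herm x : (ketbra R x : qop R n) ^t* = ketbra R x.
Proof. by rewrite /ketbra trmx_delta map_delta_mx. Qed.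

Lemma shadow_coef_real k : completely_positive L ->
  shadow_coef k = (complex.Re (shadow_coef k))%:C.
Proof.
move=> hCP; rewrite RRe_real // /shadow_coef.
apply: rpredM; first by rewrite rpredV realn.
apply: rpred_sum => C _; apply: rpred_sum => x _.
have h : expval x (L (mcf C (ketbra R x) *: gm C)) \is Num.real.
  have := cp_herm_Im hCP (enum_rank x) (herm_component hgamma C (ketbra_herm x)).
  rewrite /expval; case: (L _ _ _) => a b /= ->.
  by apply/complex_realP; exists a.
by move: h; rewrite /expval linearZ mxE mulrC.
Qed.

Lemma tame_mcoef S (G : 'I_#|bits n| -> 'I_#|bits n| -> 'M[R]_n.*2 -> R[i]) :
  (forall i j, tame (G i j)) -> tame (fun Q => mcf S (\matrix_(i, j) G i j Q)).
Proof.
move=> tG; apply: tame_cstM; apply: tame_sum => i.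
apply: (eq_tame (f := fun Q => \sum_j (gm S) ^t* i j * G j i Q)) => [Q|].
  by rewrite [RHS]mxE; apply: eq_bigr => j _; congr (_ * _); rewrite mxE.
by apply: tame_sum => j; exact: tame_cstM.
Qed.

Lemma orth_integral_mcoef S
    (G : 'I_#|bits n| -> 'I_#|bits n| -> 'M[R]_n.*2 -> R[i]) :
  (forall i j, tame (G i j)) ->
  orth_integral mu (fun Q => mcf S (\matrix_(i, j) G i j Q)) =
  mcf S (\matrix_(i, j) orth_integral mu (G i j)).
Proof.
move=> tG.
rewrite (eq_orth_integral _ (g := fun Q =>
  2 ^- n * \sum_i \sum_j (gm S) ^t* i j * G j i Q)); last first.
  move=> Q QQ; congr (_ * _); apply: eq_bigr => i _; rewrite [LHS]mxE.
  by apply: eq_bigr => j _; congr (_ * _); rewrite mxE.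
have tc c i j : tame (fun Q => c * G i j Q) by exact: tame_cstM.
rewrite (orth_integralZ hmu); last by do 2![apply: tame_sum => ?].
congr (_ * _); rewrite (orth_integral_sum hmu) => [|i]; last first.
  by do 1![apply: tame_sum => ?].
apply: eq_bigr => i _; rewrite (orth_integral_sum hmu) => [|j]; last by [].
rewrite [RHS]mxE; apply: eq_bigr => j _.
by rewrite (orth_integralZ hmu) //; congr (_ * _); rewrite mxE.
Qed.

Lemma mxtrace_proj_degree k x A :
  \tr (ketbra R x *m proj_degree gamma k A) =
  2 ^+ n * \sum_(S : {set 'I_n.*2} | #|S| == k)
    Num.conj (mcf S (ketbra R x)) * mcf S A.
Proof.
rewrite proj_degreeE mulmx_sumr raddf_sum mulr_sumr; apply: eq_bigr => S _ /=.
rewrite -scalemxAr mxtraceZ conj_mcoef ketbra_herm mulrC.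
by rewrite [in RHS]mulrA [in RHS]mulVKf ?pow2_neq0.
Qed.

Lemma shadow_expectationE (k : nat) : (k <= n)%N ->
  shadow_expectation mu L U (fhat gamma U k) = shadow_coef k.*2.
Proof.
move=> kn; pose rho : qop R n := ketbra R (zeros n).
pose c : R[i] := 2 ^+ n / 'C(n, k)%:R * 2 ^+ n.
pose F (Q : 'M[R]_n.*2) : qop R n := \matrix_(i, j) shadow_poly rho i j Q.
have tS S : tame (fun Q => mcf S (F Q)).
  by apply: tame_mcoef => i j; exact: tame_shadow_poly.
rewrite /shadow_expectation.
rewrite (eq_orth_integral _ (g := fun Q =>
  \sum_(S : {set 'I_n.*2} | #|S| == k.*2)
    (c * Num.conj (mcf S rho)) * mcf S (F Q))); last first.
  move=> Q QQ; have -> : F Q = shadow_summand rho Q.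
    by apply/matrixP => i j; rewrite mxE shadow_summandE.
  transitivity (\sum_x \sum_(S : {set 'I_n.*2} | #|S| == k.*2)
      (c * Num.conj (mcf S rho)) *
      mcf S (outcome_prob L U Q x *: rotated_ketbra U Q x)).
    apply: eq_bigr => x _; rewrite /fhat mxtrace_proj_degree.
    rewrite [X in _ * X]mulrA -/c mulrCA !mulr_sumr; apply: eq_bigr => S _.
    by rewrite mcoefZ -[RHS]mulrA; congr (c * _); exact: mulrCA.
  rewrite exchange_big; apply: eq_bigr => S _.
  by rewrite -mulr_sumr -mcoef_sum.
rewrite (orth_integral_sum hmu) => [|S]; last exact: tame_cstM.
have FE : \matrix_(i, j) orth_integral mu (shadow_poly rho i j) =
    \sum_(S : {set 'I_n.*2}) (shadow_coef #|S| * mcf S rho) *: gm S.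
  under [RHS]eq_bigr do rewrite -scalerA.
  rewrite -shadow_channelE; apply/matrixP => i j; rewrite !mxE.
  by apply: eq_orth_integral => Q QQ; rewrite -shadow_summandE.
transitivity (\sum_(S : {set 'I_n.*2} | #|S| == k.*2)
    c * shadow_coef k.*2 * (Num.conj (mcf S rho) * mcf S rho)).
  apply: eq_bigr => S /eqP Sk; rewrite (orth_integralZ hmu) //.
  rewrite orth_integral_mcoef; last exact: tame_shadow_poly.
  by rewrite (mcoef_expand hgamma S FE) Sk mulrACA.
rewrite -mulr_sumr (sum_mcoef_ketbra hgamma) /c.
have nz : 'C(n, k)%:R != 0 :> R[i] by rewrite pnatr_eq0 -lt0n bin_gt0.
have p2 := pow2_neq0 R n.
by field; rewrite nz p2.
Qed.

End Channel.

Theorem theorem2 (R : realType) (n : nat)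
    (gamma : 'I_n.*2 -> qop R n) (hgamma : majorana gamma)
    (mu : probability (borel_mx R n.*2) R) (hmu : is_haar mu)
    (U : 'M[R]_n.*2 -> qop R n)
    (hU : forall Q : 'M[R]_n.*2, Orth Q -> implements gamma Q (U Q))
    (L : {linear qop R n -> qop R n})
    (hCP : completely_positive L) (hTP : trace_preserving L) :
  exists f : 'I_n.+1 -> R,
    (forall A : qop R n,
        shadow_channel mu L U A
        = \sum_(k < n.+1) (f k)%:C *: proj_degree gamma k.*2 A) /\
    (forall k : 'I_n.+1,
        shadow_expectation mu L U (fhat gamma U k) = (f k)%:C).
Proof.
exists (fun k => complex.Re (shadow_coef gamma L k.*2)); split=> [A|k].
  rewrite (shadow_channelE hgamma hmu hU).
  rewrite (sum_even_degree _ (@shadow_coef_odd _ _ _ hgamma L)).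
  by apply: eq_bigr => k _; rewrite -(shadow_coef_real hgamma) // proj_degreeE.
rewrite -(shadow_coef_real hgamma) //.
by apply: (shadow_expectationE hgamma hmu hU); rewrite -ltnS.
Qed.
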